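(* Let $d=d_\delta$ be a rotation-invariant distance on $\mathcal{S}^{q-1}$, $d_\delta(\theta,\psi)=\delta(\theta'\psi)$, based on a function $\delta:[-1,1]\to\mathbb{R}^+$ that is anti-symmetric about $0$, i.e., $\delta(-t)+\delta(t)=\delta(-1)$ for all $t\in[-1,1]$. Let $H$ be a probability distribution on $\mathcal{S}^{q-1}$. Then: (i) $\theta\mapsto D_{d_\delta}(\theta,H)$ is anti-symmetric on $\mathcal{S}^{q-1}$ in the sense that $D_{d_\delta}(-\theta,H)=d_\delta^{\rm sup}-D_{d_\delta}(\theta,H)$ for all $\theta\in\mathcal{S}^{q-1}$; (ii) if $\theta_0\in\mathcal{S}^{q-1}$ has maximal depth (i.e., $\theta_0$ maximizes $\theta\mapsto D_{d_\delta}(\theta,H)$ over $\mathcal{S}^{q-1}$), then $-\theta_0$ has minimal depth (i.e., $-\theta_0$ minimizes it).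
   Context: Let $q\ge 2$ and $\mathcal{S}^{q-1}=\{x\in\mathbb{R}^q: x'x=1\}$, where $'$ denotes transpose; $\mathbb{R}^+=[0,\infty)$. A distance $d$ on $\mathcal{S}^{q-1}$ is a metric on this set; it is rotation-invariant if $d(O\theta,O\psi)=d(\theta,\psi)$ for all $\theta,\psi\in\mathcal{S}^{q-1}$ and all $q\times q$ orthogonal matrices $O$; any such distance is of the form $d_\delta(\theta,\psi)=\delta(\theta'\psi)$ for some $\delta:[-1,1]\to\mathbb{R}^+$. For a bounded distance $d$ put $d^{\rm sup}=\sup\{d(\theta,\psi):\theta,\psi\in\mathcal{S}^{q-1}\}$ (written $d_\delta^{\rm sup}$ for $d=d_\delta$). For a (Borel probability) distribution $H$ on $\mathcal{S}^{q-1}$, the directional $d$-depth of $\theta\in\mathcal{S}^{q-1}$ with respect to $H$ is $D_d(\theta,H)=d^{\rm sup}-E_H[d(\theta,W)]$, where $E_H$ is expectation when $W$ has distribution $H$; it is understood that $w\mapsto d(\theta,w)$ is Borel measurable for every $\theta$, so that this expectation makes sense. *)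

(* Defs.v *)
From HB Require Import structures.
From mathcomp Require Import all_boot all_order all_algebra.
From mathcomp Require Import all_classical all_reals all_analysis.
Import Order.TTheory GRing.Theory Num.Theory.
Import numFieldNormedType.Exports.

Set Implicit Arguments.
Unset Strict Implicit.
Unset Printing Implicit Defensive.

Local Open Scope classical_set_scope.
Local Open Scope ring_scope.

Definition dot (R : realType) (q : nat) (x y : 'cV[R]_q) : R :=
  (x^T *m y) 0 0.

Definition unit_sphere (R : realType) (q : nat) : set 'cV[R]_q :=
  [set x | dot x x = 1].

(* As a [set_type], the sphere carries the topology induced by that of
   'cV[R]_q. The proof hq is an argument because [measurableType] asks for a
   pointed type, whereas the sphere is empty for q = 0. *)
Definition sphere (R : realType) (q : nat) (hq : (2 <= q)%N) : Type :=
  set_type (@unit_sphere R q).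

Section sphere_structure.
Variables (R : realType) (q : nat) (hq : (2 <= q)%N).

Lemma sphere_point_subproof :
  delta_mx (Ordinal (ltnW hq)) 0 \in @unit_sphere R q.
Proof.
by apply/mem_set; rewrite /unit_sphere /= /dot trmx_delta mul_delta_mx mxE !eqxx.
Qed.

HB.instance Definition _ :=
  Topological.copy (sphere R hq) (set_type (@unit_sphere R q)).

HB.instance Definition _ := isPointed.Build (sphere R hq)
  (exist (fun x => x \in @unit_sphere R q) _ sphere_point_subproof).

HB.instance Definition _ :=
  Measurable.copy (sphere R hq) (g_sigma_algebraType (@open (sphere R hq))).

End sphere_structure.

Definition orthogonal_mx (R : realType) (q : nat) (O : 'M[R]_q) : Prop :=
  O^T *m O = 1%:M.

Section depth.
Variables (R : realType) (q : nat) (hq : (2 <= q)%N).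
Local Notation S := (sphere R hq).

Lemma rot_subproof (O : 'M[R]_q) (hO : orthogonal_mx O) (x : S) :
  O *m sval x \in @unit_sphere R q.
Proof.
apply/mem_set; rewrite /unit_sphere /= /dot trmx_mul -mulmxA (mulmxA O^T) hO.
by rewrite mul1mx; exact: (set_mem (proj2_sig x)).
Qed.

Definition rot (O : 'M[R]_q) (hO : orthogonal_mx O) (x : S) : S :=
  exist _ (O *m sval x) (rot_subproof hO x).

Lemma antipode_subproof (x : S) : - sval x \in @unit_sphere R q.
Proof.
apply/mem_set; rewrite /unit_sphere /= /dot mulmxN [(- _)^T]linearN /= mulNmx opprK.
exact: (set_mem (proj2_sig x)).
Qed.

Definition antipode (x : S) : S := exist _ (- sval x) (antipode_subproof x).

(* A distance need not be compatible with the topology of its carrier, hence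
   no [metricType]. *)
Definition is_distance (T : Type) (d : T -> T -> R) : Prop :=
  [/\ forall x y, 0 <= d x y,
      forall x y, d x y = 0 <-> x = y,
      forall x y, d x y = d y x
    & forall x y z, d x z <= d x y + d y z].

Definition rotation_invariant (d : S -> S -> R) : Prop :=
  forall (O : 'M[R]_q) (hO : orthogonal_mx O) (x y : S),
    d (rot hO x) (rot hO y) = d x y.

(* Only the values of delta on [-1, 1] matter. *)
Definition d_delta (delta : R -> R) (x y : S) : R :=
  delta (dot (sval x) (sval y)).

(* [sup] is the supremum when d is bounded; it is 0 otherwise. *)
Definition dsup (T : Type) (d : T -> T -> R) : R :=
  sup [set d x.1 x.2 | x in [set: T * T]].

(* Extended-real valued since 'E_H is; it is finite as soon as w |-> d x w is
   bounded and measurable. *)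
Definition depth (d : S -> S -> R) (H : probability S R) (x : S) : \bar R :=
  ((dsup d)%:E - 'E_H[d x])%E.

End depth.
Arguments d_delta {R q} hq delta x y.

(* Main.v *)
Require Import Defs.
From HB Require Import structures.
From mathcomp Require Import all_boot all_order all_algebra.
From mathcomp Require Import all_classical all_reals all_analysis.
From mathcomp Require Import lra.
Import Order.TTheory GRing.Theory Num.Theory.
Import numFieldNormedType.Exports.

Local Open Scope classical_set_scope.
Local Open Scope ring_scope.

(** Anti-symmetry and nonnegativity of [delta] squeeze it between [0] and
    [delta (-1)] on [[-1, 1]]: [delta t = delta (-1) - delta (- t)] is at most
    [delta (-1)].  Inner products of unit vectors lie in [[-1, 1]], and the
    value [-1] is attained at every pair of antipodes, so the supremum of the
    distance is exactly [delta (-1)] ([dsup_d_delta]).  Anti-symmetry therefore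
    reads [d (- theta) w = dsup d - d theta w] ([d_delta_antipode]), and taking
    expectations shows that the depth of [- theta] is the expected distance
    from [theta] ([depth_antipode]), which is [dsup d] minus the depth of
    [theta].  So the antipodal map exchanges depth with its complement to
    [dsup d], hence maxima with minima.

    Boundedness has a second role: together with measurability it
    makes all expectations finite, so that the extended-real subtractions can
    be cancelled. *)

Section dot_theory.
Context {R : realType} {q : nat}.
Implicit Types x y : 'cV[R]_q.

Lemma dotDl x y z : dot (x + y) z = dot x z + dot y z.
Proof. by rewrite /dot linearD mulmxDl mxE. Qed.

Lemma dotC x y : dot x y = dot y x.
Proof. by rewrite /dot -{1}(trmxK y) -trmx_mul mxE. Qed.

Lemma dotNl x y : dot (- x) y = - dot x y.
Proof. by rewrite /dot linearN mulNmx mxE. Qed.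

Lemma dot_ge0 x : 0 <= dot x x.
Proof. by rewrite /dot mxE sumr_ge0 // => i _; rewrite mxE -expr2 sqr_ge0. Qed.

(** Since the vectors are normalized, [|x + y|^2 = 2 (1 + x'y)], so that
    positivity alone gives the lower bound, without Cauchy-Schwarz. *)
Lemma dot_unit_ge x y : dot x x = 1 -> dot y y = 1 -> -1 <= dot x y.
Proof.
move=> x1 y1; have := dot_ge0 (x + y).
rewrite dotDl !(dotC _ (x + y)) !dotDl (dotC y x) x1 y1; lra.
Qed.

Lemma dot_unit_itv x y : dot x x = 1 -> dot y y = 1 -> -1 <= dot x y <= 1.
Proof.
move=> x1 y1; rewrite dot_unit_ge //= -lerN2 -dotNl dot_unit_ge //.
by rewrite dotNl dotC dotNl opprK.
Qed.

End dot_theory.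

Lemma subeKC (R : realType) (r : R) (e : \bar R) : e \is a fin_num ->
  (r%:E - (r%:E - e) = e)%E.
Proof. by case: e => // s _; rewrite -!EFinB subKr. Qed.

Section antisymmetric_distance.
Context {R : realType} {q : nat} (hq : (2 <= q)%N) (delta : R -> R).
Hypothesis delta_ge0 : forall t : R, -1 <= t <= 1 -> 0 <= delta t.
Hypothesis delta_anti : forall t : R, -1 <= t <= 1 ->
  delta (- t) + delta t = delta (-1).
Local Notation S := (sphere R hq).
Local Notation d := (d_delta hq delta).
Implicit Types x y : S.

Lemma dot_sphere x : dot (sval x) (sval x) = 1.
Proof. exact: (set_mem (proj2_sig x)). Qed.

Lemma dot_sphere_itv x y : -1 <= dot (sval x) (sval y) <= 1.
Proof. by rewrite dot_unit_itv // dot_sphere. Qed.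

Lemma d_delta_ge0 x y : 0 <= d x y.
Proof. exact/delta_ge0/dot_sphere_itv. Qed.

Lemma d_deltaN x y : d (antipode x) y = delta (-1) - d x y.
Proof.
by rewrite -(delta_anti _ (dot_sphere_itv x y)) addrK /d_delta /= dotNl.
Qed.

Lemma d_delta_le x y : d x y <= delta (-1).
Proof. by rewrite -subr_ge0 -d_deltaN d_delta_ge0. Qed.

Lemma d_delta_antipodal x : d (antipode x) x = delta (-1).
Proof. by rewrite /d_delta /= dotNl dot_sphere. Qed.

Lemma dsup_d_delta : dsup d = delta (-1).
Proof.
have ubd : ubound [set d p.1 p.2 | p in [set: S * S]] (delta (-1)).
  by move=> _ [p _ <-]; exact: d_delta_le.
have dN1 : [set d p.1 p.2 | p in [set: S * S]] (delta (-1)).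
  by exists (antipode point, point) => //; exact: d_delta_antipodal.
apply/eqP; rewrite eq_le; apply/andP; split.
  by apply: ge_sup ubd; exists (delta (-1)).
by apply: ub_le_sup dN1; exists (delta (-1)).
Qed.

(** The form of the anti-symmetry that no longer refers to [delta]. *)
Lemma d_delta_antipode x y : d (antipode x) y = dsup d - d x y.
Proof. by rewrite dsup_d_delta d_deltaN. Qed.

Section depth.
Hypothesis d_meas : forall x, measurable_fun [set: S] (d x).
Variable H : probability S R.

Lemma d_delta_Lfun x : d x \in Lfun H 1.
Proof.
apply/Lfun1_integrable/measurable_bounded_integrable => //.
  by rewrite [X in (X < _)%E](@probability_setT _ _ _ H) ltry.
exists (delta (-1)); split; first exact: num_real.
move=> M ltM y _ /=; rewrite ger0_norm ?d_delta_ge0 //.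
exact: le_trans (d_delta_le x y) (ltW ltM).
Qed.

Lemma expectation_d_delta_fin_num x : 'E_H[d x]%E \is a fin_num.
Proof. exact/expectation_fin_num/d_delta_Lfun. Qed.

Lemma depth_fin_num x : depth d H x \is a fin_num.
Proof. by rewrite /depth fin_numB expectation_d_delta_fin_num. Qed.

(** Depth at the antipode measures remoteness: the two occurrences of [dsup d],
    one from the definition of depth and one from [d_delta_antipode],
    cancel. *)
Lemma depth_antipode x : depth d H (antipode x) = 'E_H[d x]%E.
Proof.
rewrite /depth.
have -> : d (antipode x) = cst (dsup d) \- d x.
  by apply/funext => y; rewrite d_delta_antipode.
rewrite expectationB ?Lfun_cst ?d_delta_Lfun // expectation_cst.
by rewrite subeKC ?expectation_d_delta_fin_num.
Qed.

Lemma depth_antisymmetric x :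
  depth d H (antipode x) = ((dsup d)%:E - depth d H x)%E.
Proof.
by rewrite depth_antipode /depth subeKC ?expectation_d_delta_fin_num.
Qed.

End depth.
End antisymmetric_distance.

Theorem theorem5 (R : realType) (q : nat) (hq : (2 <= q)%N)
    (delta : R -> R)
    (delta_ge0 : forall t : R, -1 <= t <= 1 -> 0 <= delta t)
    (d_dist : is_distance (d_delta hq delta))
    (d_rot : rotation_invariant (d_delta hq delta))
    (d_meas : forall theta : sphere R hq,
      measurable_fun [set: sphere R hq] (d_delta hq delta theta))
    (delta_anti : forall t : R, -1 <= t <= 1 ->
      delta (- t) + delta t = delta (-1))
    (H : probability (sphere R hq) R) :
  (forall theta : sphere R hq,
     depth (d_delta hq delta) H (antipode theta) =
     ((dsup (d_delta hq delta))%:E - depth (d_delta hq delta) H theta)%E) /\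
  (forall theta0 : sphere R hq,
     (forall theta : sphere R hq,
        (depth (d_delta hq delta) H theta <=
         depth (d_delta hq delta) H theta0)%E) ->
     forall theta : sphere R hq,
       (depth (d_delta hq delta) H (antipode theta0) <=
        depth (d_delta hq delta) H theta)%E).
Proof.
have antisym := depth_antisymmetric hq delta delta_ge0 delta_anti d_meas H.
split=> // theta0 max0 theta.
have fin := depth_fin_num hq delta delta_ge0 delta_anti d_meas H.
(* Maximality of [theta0], tested against [- theta], is the claim. *)
rewrite antisym leeBlDr // addeC -leeBlDr // -antisym.
exact: max0.
Qed.
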